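(* Let $X$ be a finite regular CW complex and let $M$ be a matroid with lattice of flats $L(M)$. Then $$f(\mathscr{T}_X M; t) = 1 + \sum_{p \in L(M)} \frac{\bigl(f(\Delta^{\circ}_M(p); t)-1\bigr)\cdot \bigl(f(X; t)^{\operatorname{corank}(p)} - 1\bigr)}{t},$$ where $\mathscr{T}_X M$ is the Engström representation of $M$ indexed by $X$ and $\Delta^{\circ}_M(p)$ is the open star of $p$ in the order complex $\Delta(L(M)_{\leq p})$.
   Context: Matroids have finite ground set. $L(M)$ is the lattice of flats of $M$, ordered by inclusion; $r$ is the rank of $M$, and $\operatorname{corank}(p) = r - \operatorname{rk}(p)$ for $p\in L(M)$. $\Delta(P)$ denotes the order complex of a poset $P$ (the simplicial complex of chains of $P$), and $L(M)_{\le p}=\{q\in L(M): q\le p\}$. Engström representation. For $p\in L(M)$ let $D(p)$ be the join of $\operatorname{corank}(p)$ copies of $X$, the copies being indexed by $\{1,2,\dots,\operatorname{corank}(p)\}$ (the empty join is the empty space); $D(p)$ has the standard cell structure of a join. For $p\ge q$ in $L(M)$ let $d_{pq}: D(p)\to D(q)$ be the inclusion induced by $\{1,\dots,\operatorname{corank}(p)\}\subseteq\{1,\dots,\operatorname{corank}(q)\}$. The Engström representation is the homotopy colimit $$\mathscr{T}_X M = \coprod_{p\in L(M)} \bigl(\Delta(L(M)_{\le p})\times D(p)\bigr)\big/\sim,$$ where $\sim$ is the equivalence relation generated by: for $(a,x)\in\Delta(L(M)_{\le p})\times D(p)$ and $(b,y)\in\Delta(L(M)_{\le q})\times D(q)$,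 $(a,x)\sim(b,y)$ if $p\ge q$, $d_{pq}(x)=y$ and $a=b$. It is regarded as a CW complex whose open cells are the images of the open product cells $\sigma\times e$ of the spaces $\Delta(L(M)_{\le p})\times D(p)$ (identified cells being counted once). $f$-polynomial. For a finite CW complex $\Delta$, $f(\Delta;t)=\sum_{i\ge 0} f_{i-1}(\Delta)t^i$, where for $i\ge1$, $f_{i-1}(\Delta)$ is the number of $(i-1)$-dimensional cells, and $f_{-1}(\Delta)=1$ by convention (the empty face), also when $\Delta$ is empty. The open star $\Delta^{\circ}_M(p)$ is the union of all open simplices of $\Delta(L(M)_{\le p})$ whose closures contain the vertex $p$; its $f$-polynomial is defined in the same way by counting these open simplices by dimension, with $f_{-1}=1$. *)

(* Defs.v *)
From HB Require Import structures.
From Stdlib Require Import Relation_Operators.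
From mathcomp Require Import all_boot all_order all_algebra.
From mathcomp Require Import finmap generic_quotient fraction.
From mathcomp Require Import all_classical all_reals all_analysis.

Set Implicit Arguments.
Unset Strict Implicit.
Unset Printing Implicit Defensive.

Import Order.TTheory GRing.Theory Num.Theory.
Import numFieldNormedType.Exports.

Local Open Scope classical_set_scope.
Local Open Scope ring_scope.
Local Open Scope quotient_scope.

(* A family of open cells on Y: [K d] is the set of the open d-cells. A cell is
   a subset of Y, so it is counted once however many times it is described. *)
Definition cells (Y : Type) := nat -> set (set Y).

(* [fnum K i] is f_{i-1}: f_{-1} = 1 accounts for the empty face. *)
Definition fnum (Y : Type) (K : cells Y) (i : nat) : nat :=
  if i is d.+1 then #|` fset_set (K d) |%fset else 1%N.

(* The sum over all i is the finitely supported sum of [fsbigop]; it is the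
   intended one because all the cell families below are finite. *)
Definition fpoly (Y : Type) (K : cells Y) : {poly int} :=
  \sum_(i \in [set: nat]) (fnum K i)%:R *: ('X^i : {poly int}).

(* Balls are Euclidean; the library norm on row vectors is the sup norm. *)
Definition closed_disk (R : realType) (d : nat) : set 'rV[R]_d :=
  [set v | \sum_i v ord0 i ^+ 2 <= 1].
Definition open_disk (R : realType) (d : nat) : set 'rV[R]_d :=
  [set v | \sum_i v ord0 i ^+ 2 < 1].
Definition sphere (R : realType) (d : nat) : set 'rV[R]_d :=
  [set v | \sum_i v ord0 i ^+ 2 = 1].

Arguments closed_disk : clear implicits.
Arguments open_disk : clear implicits.
Arguments sphere : clear implicits.

Definition homeo_on_image (U V : topologicalType) (A : set U) (f : U -> V) :=
  {within A, continuous f} /\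
  exists g : V -> U,
    {within f @` A, continuous g} /\ (forall x, A x -> g (f x) = x).

(* The characteristic maps of a regular CW complex are homeomorphisms on the
   closed ball. Closure-finiteness and the weak topology are automatic for
   finitely many cells. The space may be empty. *)
Record finite_regular_cw (R : realType) (X : topologicalType) (K : cells X) :
    Prop := FiniteRegularCW {
  cw_hausdorff : hausdorff_space X;
  cw_finite : finite_set (\bigcup_d K d);
  cw_cover : \bigcup_d \bigcup_(C in K d) C = [set: X];
  cw_disjoint : forall d d' C C', K d C -> K d' C' ->
    C `&` C' !=set0 -> d = d' /\ C = C';
  cw_char : forall d C, K d C -> exists phi : 'rV[R]_d -> X,
    [/\ homeo_on_image (closed_disk R d) phi,
        phi @` open_disk R d = C &
        phi @` sphere R d `<=`
          \bigcup_(d' in [set k | (k < d)%N]) \bigcup_(C' in K d') C'] }.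

Record matroid (E : finType) := Matroid {
  indep : {set {set E}};
  indep0 : finset.set0 \in indep;
  indepS : forall A B : {set E}, A \subset B -> B \in indep -> A \in indep;
  indep_aug : forall A B : {set E}, A \in indep -> B \in indep ->
    (#|A| < #|B|)%N -> exists2 e, e \in B :\: A & (e |: A)%SET \in indep }.

Definition mrank (E : finType) (M : matroid E) (A : {set E}) : nat :=
  (\max_(B in indep M | B \subset A) #|B|)%N.

Definition is_flat (E : finType) (M : matroid E) (F : {set E}) : bool :=
  [forall e, (e \notin F) ==> (mrank M F < mrank M (e |: F)%SET)%N].

Record flat (E : finType) (M : matroid E) := Flat {
  flat_set :> {set E};
  _ : is_flat M flat_set }.

HB.instance Definition _ (E : finType) (M : matroid E) :=
  [isSub for @flat_set E M].
HB.instance Definition _ (E : finType) (M : matroid E) :=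
  [Finite of flat M by <:].

Fact flat_display : Order.disp_t. Proof. exact: Order.Disp tt tt. Qed.

Section FlatOrder.
Variables (E : finType) (M : matroid E).

Definition flat_le (p q : flat M) : bool := (p : {set E}) \subset q.

Lemma flat_le_refl : reflexive flat_le.
Proof. by move=> p; exact: subxx. Qed.

Lemma flat_le_anti : antisymmetric flat_le.
Proof.
move=> p q pq; apply: val_inj; apply/eqP.
by rewrite finset.eqEsubset; exact: pq.
Qed.

Lemma flat_le_trans : transitive flat_le.
Proof. by move=> q p r pq qr; exact: fintype.subset_trans pq qr. Qed.

HB.instance Definition _ := Order.Le_isPOrder.Build flat_display (flat M)
  flat_le_refl flat_le_anti flat_le_trans.

Definition corank (p : flat M) : nat := (mrank M [set: E]%SET - mrank M p)%N.

Lemma corank_le (p q : flat M) : (q <= p)%O -> (corank p <= corank q)%N.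
Proof.
move=> qp; apply: leq_sub2l; apply/bigmax_leqP => B /andP[BI Bq].
by apply: leq_bigmax_cond; rewrite BI (fintype.subset_trans Bq qp).
Qed.

End FlatOrder.

Section OrderComplex.
Variables (R : realType) (disp : Order.disp_t) (L : finPOrderType disp).
Implicit Types (A s : {set L}) (p : L).

Definition is_simplex A s : Prop :=
  [/\ s != finset.set0, s \subset A & {in s &, forall x y, (x >=< y)%O}].

Definition supp (a : L -> R) : {set L} := [set q | a q != 0]%SET.

(* The geometric realization, in barycentric coordinates. The coordinates are
   indexed by all of L, so that the realization for A is literally contained in
   the one for B when A is a subset of B. *)
Definition realization A : set {ptws L -> R} :=
  [set a | [/\ forall q, 0 <= a q, \sum_q a q = 1 & is_simplex A (supp a)]].

Definition order_complex A : topologicalType := set_type (realization A).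

Definition coord A (a : order_complex A) : L -> R := set_val a.

Definition open_simplex A s : set (order_complex A) :=
  [set a | supp (coord a) = s].

Definition order_cells A : cells (order_complex A) := fun d =>
  [set C | exists s : {set L},
     [/\ is_simplex A s, #|s| = d.+1 & C = @open_simplex A s]].

Arguments order_cells : clear implicits.

Definition down p : {set L} := [set q | (q <= p)%O]%SET.

Definition vertex_coord p : {ptws L -> R} := fun q => (q == p)%:R.

Lemma vertex_subproof p : vertex_coord p \in realization (down p).
Proof.
have sE : supp (vertex_coord p) = [set p]%SET.
  by apply/setP => q; rewrite !inE pnatr_eq0 eqb0 negbK.
apply/mem_set; split=> [q|/=|]; first by rewrite ler0n.
- by rewrite (bigD1 p) //= /vertex_coord eqxx big1 ?addr0 // => q /negPf ->.
- rewrite sE; split.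
  + by apply/finset.set0Pn; exists p; rewrite inE.
  + by rewrite finset.sub1set inE.
  + by move=> x y; rewrite !inE => /eqP -> /eqP ->; exact: comparablexx.
Qed.

Definition vertex p : order_complex (down p) :=
  exist (fun a => a \in realization (down p)) _ (vertex_subproof p).

(* The open star of p is the union of these open simplices. *)
Definition star_cells p : cells (order_complex (down p)) := fun d =>
  [set C | order_cells (down p) d C /\ closure C (vertex p)].

End OrderComplex.

Arguments order_cells R {disp L} A.
Arguments star_cells R {disp L} p.

Definition std_simplex (R : realType) (n : nat) : set {ptws 'I_n -> R} :=
  [set t | (forall i, 0 <= t i) /\ \sum_i t i = 1].
Arguments std_simplex : clear implicits.

Section Join.
Variables (R : realType) (X : topologicalType).

(* Formal convex combinations t_0 x_0 + ... + t_(n-1) x_(n-1). The space is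
   empty for n = 0, since the coefficients must sum to 1. *)
Definition prejoin (n : nat) : topologicalType :=
  (set_type (std_simplex R n) * {ptws 'I_n -> X})%type.

Definition weight n (z : prejoin n) : 'I_n -> R := set_val z.1.
Definition node n (z : prejoin n) : 'I_n -> X := z.2.

(* x_i is irrelevant when t_i = 0. *)
Definition join_rel n (z z' : prejoin n) : bool :=
  `[< weight z = weight z' /\
      forall i, weight z i != 0 -> node z i = node z' i >].

Lemma join_rel_refl n : reflexive (@join_rel n).
Proof. by move=> z; apply/asboolP. Qed.

Lemma join_rel_sym n : symmetric (@join_rel n).
Proof.
move=> z z'; apply/asboolP/asboolP => -[wE pE]; split=> // i;
  by rewrite -?wE => /pE -> //; rewrite wE.
Qed.

Lemma join_rel_trans n : transitive (@join_rel n).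
Proof.
move=> z2 z1 z3 /asboolP[w12 p12] /asboolP[w23 p23]; apply/asboolP; split.
  by rewrite w12.
by move=> i wi; rewrite p12 // p23 // -w12.
Qed.

Definition join_equiv n : equiv_rel (prejoin n) :=
  EquivRel (@join_rel n) (@join_rel_refl n) (@join_rel_sym n)
    (@join_rel_trans n).

Definition join (n : nat) : topologicalType :=
  quotient_topology {eq_quot (join_equiv n)}.

Definition join_pi n (z : prejoin n) : join n := \pi_(join n) z.

Lemma join_piP n (z z' : prejoin n) :
  join_pi z = join_pi z' <->
  weight z = weight z' /\ (forall i, weight z i != 0 -> node z i = node z' i).
Proof.
by split=> [/eqmodP/asboolP|zz']; [|apply/eqmodP/asboolP].
Qed.

(* The standard cells of the join: a nonempty set S of copies, with a cell
   [e i] of X, of dimension [m i], for each i in S. *)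
Definition join_cell n (S : {set 'I_n}) (e : 'I_n -> set X) : set (join n) :=
  [set @join_pi n z | z in [set z : prejoin n | forall i,
     if i \in S then 0 < weight z i /\ e i (node z i) else weight z i = 0]].

Definition join_cells (K : cells X) (n : nat) : cells (join n) := fun d =>
  [set C | exists (S : {set 'I_n}) (m : 'I_n -> nat) (e : 'I_n -> set X),
     [/\ S != finset.set0, (forall i, i \in S -> K (m i) (e i)),
         d.+1 = (\sum_(i in S) (m i).+1)%N & C = join_cell S e]].

Section Inclusion.
Variables (n m : nat) (h : (n <= m)%N).

Lemma std_simplex_ord (t : set_type (std_simplex R n)) : 'I_n.
Proof.
case: n t => [[t /set_mem [_ t1]]|k _]; last exact: ord0.
by exfalso; move/eqP: t1; rewrite big_ord0 eq_sym oner_eq0.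
Qed.

Definition incl_weight (z : prejoin n) : {ptws 'I_m -> R} :=
  fun j => \sum_(i | widen_ord h i == j) weight z i.

Lemma incl_weight_subproof (z : prejoin n) : incl_weight z \in std_simplex R m.
Proof.
have [w0 w1] := set_mem (valP z.1); apply/mem_set; split=> [j|/=].
  by apply: sumr_ge0 => i _; exact: w0.
rewrite (exchange_big_dep xpredT) //= -[RHS]w1.
apply: eq_bigr => i _; rewrite (eq_bigl (pred1 (widen_ord h i))) ?big_pred1_eq //.
Qed.

(* The new copies get weight 0; the points chosen there are irrelevant. *)
Definition prejoin_incl (z : prejoin n) : prejoin m :=
  (exist (fun t => t \in std_simplex R m) _ (incl_weight_subproof z),
   fun j => node z (odflt (std_simplex_ord z.1)
                           [pick i | widen_ord h i == j])).

(* The inclusion of joins induced by {0,..,n-1} in {0,..,m-1}. *)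
Definition join_incl (z : join n) : join m := join_pi (prejoin_incl (repr z)).

Lemma join_inclE (z : prejoin n) :
  join_incl (join_pi z) = join_pi (prejoin_incl z).
Proof.
have /join_piP[wE pE] : join_pi (repr (join_pi z)) = join_pi z.
  exact: reprK.
apply/join_piP; split.
  by apply/funext => j; apply: eq_bigr => i _; rewrite wE.
move=> j; rewrite -[weight _ j]/(incl_weight _ j) /incl_weight /node /=.
case: pickP => [i /eqP ij|nj] /=; last by rewrite big_pred0 ?eqxx.
move=> wj; apply: pE; apply: contra_neq wj => wi.
rewrite big1 // => k /eqP kj; rewrite -wi; congr (weight _ _).
by apply: val_inj; rewrite -[val k]/(val (widen_ord h k)) kj -ij.
Qed.

End Inclusion.
End Join.

Arguments join_cells R {X} K n.

Section Engstrom.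
Variables (R : realType) (X : topologicalType).
Variables (E : finType) (M : matroid E).

Definition engstrom_piece (p : flat M) : topologicalType :=
  (order_complex R (down p) * join R X (corank p))%type.

Definition engstrom_coprod : topologicalType := {p : flat M & engstrom_piece p}.

(* (a, x) over p is identified with (b, y) over q when q <= p, d_pq x = y and
   a = b as points of the order complex of the whole lattice of flats. *)
Definition engstrom_step (u v : engstrom_coprod) : Prop :=
  exists h : (tag v <= tag u)%O,
    join_incl (corank_le h) (tagged u).2 = (tagged v).2 /\
    coord (tagged u).1 = coord (tagged v).1.

Definition engstrom_rel (u v : engstrom_coprod) : bool :=
  `[< clos_refl_sym_trans _ engstrom_step u v >].

Lemma engstrom_rel_refl : reflexive engstrom_rel.
Proof. by move=> u; apply/asboolP; exact: rst_refl. Qed.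

Lemma engstrom_rel_sym : symmetric engstrom_rel.
Proof. by move=> u v; apply/asboolP/asboolP; exact: rst_sym. Qed.

Lemma engstrom_rel_trans : transitive engstrom_rel.
Proof.
move=> v u w /asboolP uv /asboolP vw; apply/asboolP; exact: rst_trans uv vw.
Qed.

Definition engstrom_equiv : equiv_rel engstrom_coprod :=
  EquivRel engstrom_rel engstrom_rel_refl engstrom_rel_sym engstrom_rel_trans.

Definition engstrom : topologicalType :=
  quotient_topology {eq_quot engstrom_equiv}.

Definition engstrom_pi (u : engstrom_coprod) : engstrom := \pi_engstrom u.

(* The dimension of a cell is that of the product cells it is the image of;
   product cells with the same image have the same dimension. *)
Definition engstrom_cells (K : cells X) : cells engstrom := fun d =>
  [set C | exists (p : flat M) (i j : nat)
      (s : set (order_complex R (down p))) (e : set (join R X (corank p))),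
     [/\ order_cells R (down p) i s, join_cells R K (corank p) j e, d = (i + j)%N &
         C = [set engstrom_pi (existT _ p z) | z in s `*` e]]].

End Engstrom.

Arguments engstrom_cells R {X E} M K.

Notation "x %:F" := (tofrac x) : ring_scope.

(* Main.v *)
From Pilot Require Import Defs.
From Stdlib Require Import Relation_Operators.
From mathcomp Require Import all_boot all_order all_algebra.
From mathcomp Require Import finmap fraction.
From mathcomp Require Import all_classical all_reals all_analysis.
(* Some names of the definitions, such as [down], are also used by the analysis
   files; this import gives the definitions priority. *)
Import Pilot.Defs.

Set Implicit Arguments.
Unset Strict Implicit.
Unset Printing Implicit Defensive.
Import Order.TTheory GRing.Theory Num.Theory.
Import numFieldNormedType.Exports.
Local Open Scope classical_set_scope.
Local Open Scope ring_scope.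

(** A point of the Engstrom representation is the class of a pair [(a, x)] over
    a flat [p], where [a] lies in the order complex below [p] and [x] in the join
    [D(p)]. Let [q] be the largest flat in the support of [a]. Then [q <= p], and
    the identifications move [(a, x)] down to [q], the smallest flat over which
    [a] still lives. So every cell comes from exactly one triple: a flat [q], a
    chain with top [q], and a cell of [D(q)]. This uniqueness needs that no
    chain of identifications can merge two such triples. It follows from an
    invariant of the identifications, the barycentric coordinates of [a]
    together with the set of weighted points that [x] is made of
    ([engstrom_pi_code]): it determines [q] as the top of the support of [a],
    and then [x] within [D(q)]. That every cell is reached is
    [product_cell_top], which uses that the inclusions of joins map cells onto
    cells ([label_cell_incl]).

    The chains with top [q] are the simplices of the open star of [q]; this is
    the one topological point ([closure_open_simplex]). The cells of the join of
    [n] copies of [X] are counted by [f(X)^n - 1] ([fpoly_join]), since with one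
    more than the dimension as exponent the count is multiplicative under joins,
    the empty face included. A product of an [i]-cell and a [j]-cell has exponent
    [(i + 1) + (j + 1) - 1], and this [- 1] is the division by [t].

    All the counts go through [fpoly_index]: a family of pairwise disjoint
    nonempty cells indexed by a finite type has as [f]-polynomial 1 plus the sum
    of the monomials of its indices. *)

(** * Counting cells by a finite index type *)

(** The predicate on the index type avoids dependent subtypes, whose sums would
    be harder to rearrange. Cells are compared through their points: together
    with nonemptiness, disjointness makes the indexing injective, so that
    counting cells amounts to counting indices. *)
Record indexes (Y : Type) (K : cells Y) (T : finType) (P : pred T)
    (dim : T -> nat) (c : T -> set Y) : Prop := Indexes {
  index_cells : forall d C, K d C <-> exists x, [/\ P x, dim x = d & C = c x];
  index_nonempty : forall x, P x -> c x !=set0;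
  index_disjoint : forall x y z, P x -> P y -> c x z -> c y z -> x = y }.

Section FPoly.
Variables (Y : Type) (K : cells Y) (T : finType) (P : pred T).
Variables (dim : T -> nat) (c : T -> set Y).

Lemma fnum_index d : indexes K P dim c ->
  fnum K d.+1 = #|[pred x | P x && (dim x == d)]|.
Proof.
case=> cE n0 disj /=.
have c_inj : {in [pred x | P x && (dim x == d)] &, injective c}.
  move=> x y /andP[Px _] /andP[Py _] cxy; have [z xz] := n0 x Px.
  by apply: (disj x y z) => //; rewrite -cxy.
have -> : K d = [set` [fset c x | x in [pred x | P x && (dim x == d)]]%fset].
  apply/seteqP; split=> C /=.
    move=> /cE[x [Px dx ->]]; apply/imfsetP; exists x => //.
    by apply/andP; rewrite Px dx eqxx.
  by move=> /imfsetP[x /andP[Px /eqP dx] ->]; apply/cE; exists x.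
by rewrite set_fsetK card_in_imfset // cardE.
Qed.

Lemma fpoly_index : indexes K P dim c ->
  fpoly K = 1 + \sum_(x | P x) 'X^((dim x).+1).
Proof.
move=> idxK; pose N := (\max_x dim x).+1.
have dimN x : (dim x < N)%N by rewrite ltnS leq_bigmax.
(* Beyond the largest dimension all coefficients vanish, so the finitely
   supported sum is an ordinary one. *)
have high i : (N < i)%N -> (fnum K i)%:R *: ('X^i : {poly int}) = 0.
  case: i => // i Ni; rewrite (fnum_index _ idxK) eq_card0 ?scale0r // => x.
  apply/negbTE/negP => /andP[_ /eqP dx].
  by have := dimN x; rewrite dx ltnNge -ltnS Ni.
rewrite /fpoly -(@fsbig_widen _ _ _ _ [set` iota 0 N.+1]) //; last first.
  by move=> i [_ /negP]; rewrite /mkset mem_iota add0n -leqNgt => /high.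
rewrite -fsbig_seq ?iota_uniq // -{1}[N.+1]subn0 -/(index_iota 0 N.+1).
rewrite big_mkord big_ord_recl expr0 scale1r; congr (_ + _).
rewrite (partition_big (fun x => Ordinal (dimN x)) xpredT) //.
apply: eq_bigr => i _; rewrite lift0 (fnum_index _ idxK).
rewrite (eq_bigr (fun=> 'X^(i.+1) : {poly int})); last first.
  by move=> x /andP[_ /eqP <-].
by rewrite sumr_const scaler_nat; congr (_ *+ _); apply: eq_card => x.
Qed.
End FPoly.

(** * Cells of the finite CW complex *)

Lemma cw_index (R : realType) (X : topologicalType) (K : cells X) :
  finite_regular_cw R K ->
  exists (T : finType) (dim : T -> nat) (c : T -> set X),
    indexes K xpredT dim c.
Proof.
case=> _ finK _ disjK charK.
have nonempty d C : K d C -> C !=set0.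
  move=> /charK[phi [_ <- _]]; exists (phi 0), 0 => //.
  (* The open disk contains its centre, also in dimension 0. *)
  by rewrite /open_disk /= big1 // => i _; rewrite mxE expr0n.
pose T : finType := fset_set (\bigcup_d K d).
have TP (x : T) : exists d, K d (val x).
  have := valP x; rewrite in_fset_set // inE => -[d _ Kd].
  by exists d.
exists T, (fun x => sval (cid (TP x))), val; split=> [d C|x _|x y z _ _ xz yz].
- split=> [KdC|[x [_ <- ->]]]; last by case: cid.
  have CT : C \in fset_set (\bigcup_d K d).
    by rewrite in_fset_set // inE; exists d.
  exists [` CT]%fset; split=> //; case: cid => d' /= Kd'.
  have [z Cz] := nonempty _ _ KdC.
  by have [] := disjK _ _ _ _ Kd' KdC (ex_intro _ z (conj Cz Cz)).
- by have [d /nonempty] := TP x.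
- have [[d Kx] [d' Ky]] := (TP x, TP y).
  apply: val_inj.
  by have [] := disjK _ _ _ _ Kx Ky (ex_intro _ z (conj xz yz)).
Qed.

(** * Cells of the join *)

Section JoinCells.
Variables (R : realType) (X : topologicalType).

Lemma eq_join_cell n (S : {set 'I_n}) (e e' : 'I_n -> set X) :
  {in S, e =1 e'} -> join_cell (R := R) S e = join_cell S e'.
Proof.
move=> ee'; congr (_ @` _); apply/seteqP; split=> z ez i; have := ez i;
  by case: ifP => // iS; rewrite ee'.
Qed.

Variables (K : cells X) (T : finType) (dim : T -> nat) (c : T -> set X).
Hypothesis idxK : indexes K xpredT dim c.

(** One more than the dimension, and 0 for an unused copy: these add up under
    joins. *)
Definition option_dim (o : option T) : nat :=
  if o is Some x then (dim x).+1 else 0.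
Definition option_cell (o : option T) : set X :=
  if o is Some x then c x else set0.

(** A cell of the [n]-fold join picks, for each of the [n] copies, either nothing
    or a cell of [X], but not nothing everywhere. Recording the choice as a label
    [f], a function to [option T], turns the count into an expanded product: an
    option contributes [t^0] or [t^(dim + 1)], and the constant [None] accounts
    for the term [1] of the [f]-polynomial. *)
Section Fixed.
Variable n : nat.
Implicit Types f : {ffun 'I_n -> option T}.

Definition label_supp f : {set 'I_n} := [set i | f i != None]%SET.
Definition fits f (z : prejoin R X n) : Prop := forall i,
  if f i is Some x then 0 < weight z i /\ c x (node z i) else weight z i = 0.
Definition label_cell f : set (join R X n) := @join_pi R X n @` fits f.

Lemma label_cellE f :
  label_cell f = join_cell (label_supp f) (option_cell \o f).
Proof.
by congr (_ @` _); apply/seteqP; split=> z zf i; have := zf i;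
  rewrite inE /=; case: (f i).
Qed.

Definition label_dim f : nat := (\sum_i option_dim (f i)).-1.
Definition nonempty_label f := f != [ffun=> None].

Lemma label_supp_n0 f : nonempty_label f = (label_supp f != finset.set0).
Proof.
congr (~~ _); apply/eqP/eqP => [->|/setP f0].
  by apply/setP => i; rewrite !inE ffunE.
by apply/ffunP => i; have := f0 i; rewrite !inE ffunE => /negbFE/eqP.
Qed.

Lemma label_dimS f :
  nonempty_label f -> (label_dim f).+1 = (\sum_i option_dim (f i))%N.
Proof.
rewrite label_supp_n0 => /finset.set0Pn[i].
rewrite inE /label_dim (bigD1 i) //=.
by case: (f i).
Qed.

Lemma label_cell_n0 f : nonempty_label f -> label_cell f !=set0.
Proof.
rewrite label_supp_n0 => fn0.
have S0 : (0 < #|label_supp f|)%N by rewrite card_gt0.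
have [i0 i0S] := finset.set0Pn _ fn0.
(* Unused copies carry an arbitrary point, which a used copy provides. *)
have pt i : exists y, i \in label_supp f -> option_cell (f i) y.
  have ne j : j \in label_supp f -> option_cell (f j) !=set0.
    by rewrite inE; case: (f j) => // x _; exact: (index_nonempty idxK isT).
  have [iS|_] := boolP (i \in label_supp f).
    by have [y fy] := ne i iS; exists y.
  by have [y _] := ne i0 i0S; exists y.
have [y yP] := choice pt.
pose w : {ptws 'I_n -> R} := fun i =>
  if i \in label_supp f then #|label_supp f|%:R^-1 else 0.
have w1 : w \in std_simplex R n.
  apply/mem_set; split=> [i|/=].
    by rewrite /w; case: ifP; rewrite ?invr_ge0.
  rewrite -big_mkcond /= sumr_const -[_ *+ _]mulr_natr mulVf //.
  by rewrite pnatr_eq0 -lt0n.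
pose z : prejoin R X n := (exist (fun t => t \in std_simplex R n) w w1, y).
exists (join_pi z), z => // i; have wE : weight z i = w i by [].
have := yP i; rewrite wE /w inE; case: (f i) => //= x /(_ isT) cx.
by rewrite invr_gt0 ltr0n.
Qed.

(** A point of the join determines the copies of nonzero weight and, on those
    copies, its coordinates in [X]; these lie in at most one cell each. *)
Lemma label_cell_disjoint f g u : label_cell f u -> label_cell g u -> f = g.
Proof.
move=> [z zf <-] [z' zg /join_piP[wE nE]]; apply/ffunP => i.
have := zf i; have := zg i; rewrite wE.
have := nE i; rewrite wE; case: (f i) (g i) => [x|] [y|] //=.
- move=> /[swap] -[w0 cy] /(_ (lt0r_neq0 w0)) yx [_ cx].
  by congr Some; apply: (index_disjoint idxK (z := node z i)); rewrite // -yx.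
- by move=> _ -> []; rewrite ltxx.
- by move=> _ [+ _] w0; rewrite w0 ltxx.
Qed.

Lemma join_index :
  indexes (join_cells R K n) nonempty_label label_dim label_cell.
Proof.
split=> [d C|f|f g u _ _]; [|exact: label_cell_n0|exact: label_cell_disjoint].
split=> [[S [m [e [S0 Ke dE ->]]]]|[f [f0 fd ->]]]; last first.
  exists (label_supp f), (fun i => (option_dim (f i)).-1), (option_cell \o f).
  split; last exact: label_cellE.
  - by rewrite -label_supp_n0.
  - move=> i; rewrite inE /=; case: (f i) => //= x _.
    by apply/(index_cells idxK); exists x.
  - rewrite -fd label_dimS // [RHS]big_mkcond; apply: eq_bigr => i _.
    by rewrite inE; case: (f i).
have pick i : exists o : option T, if i \in S then
    option_dim o = (m i).+1 /\ e i = option_cell o else o = None.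
  have [iS|_] := boolP (i \in S); last by exists None.
  by have /(index_cells idxK)[x [_ <- ->]] := Ke i iS; exists (Some x).
have [h hP] := choice pick; pose f := [ffun i => h i].
have fS : label_supp f = S.
  apply/setP => i; rewrite inE ffunE; have := hP i.
  by case: ifP => _; [case: (h i) => // -[]|move=> ->].
have f0 : nonempty_label f by rewrite label_supp_n0 fS.
exists f; split=> //.
  apply: succn_inj; rewrite label_dimS // dE [RHS]big_mkcond.
  apply: eq_bigr => i _.
  by rewrite ffunE; have := hP i; case: ifP => [_ []|_ ->].
rewrite label_cellE fS; apply: eq_join_cell => i iS /=; rewrite ffunE.
by have := hP i; rewrite iS => -[].
Qed.

(** Expanding [fpoly K ^+ n] distributively yields one monomial for each choice
    of an option in every copy, also for [n = 0], where the join is empty. *)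
Lemma fpoly_join : fpoly (join_cells R K n) = fpoly K ^+ n.
Proof.
rewrite (fpoly_index join_index) (fpoly_index idxK).
transitivity (\sum_(f : {ffun 'I_n -> option T})
    \prod_i 'X^(option_dim (f i)) : {poly int}).
  rewrite [RHS](bigD1 [ffun=> None]) //=; congr (_ + _).
    by rewrite big1 // => i _; rewrite ffunE.
  by apply: eq_bigr => f f0; rewrite label_dimS // -prodrXr.
rewrite -(bigA_distr_bigA (fun _ o => 'X^(option_dim o))).
rewrite prodr_const card_ord; congr (_ ^+ _).
rewrite (bigD1 None) //=; congr (_ + _).
rewrite (reindex_omap Some id) /=; last by case.
by apply: eq_bigl => x; rewrite eqxx.
Qed.
End Fixed.
End JoinCells.

(** * Simplices of the order complex and the open star *)

Section OrderCells.
Variables (R : realType) (disp : Order.disp_t) (L : finPOrderType disp).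
Implicit Types (A s : {set L}) (p q : L).

(** In a chain the element with the largest principal ideal is the top one. *)
Lemma chain_top A s : is_simplex A s -> exists2 q, q \in s & s \subset down q.
Proof.
case=> /finset.set0Pn[x0 x0s] _ sC.
case: (arg_maxnP (fun q => #|down q|) x0s) => q qs qmax.
exists q => //; apply/fintype.subsetP => x xs; rewrite inE.
have [//|qx] := orP (sC _ _ xs qs).
suff /eqP dE : down q == down x.
  have : x \in down x by rewrite inE.
  by rewrite -dE inE.
rewrite finset.eqEcard (qmax x xs : (_ <= _)%N) andbT.
by apply/fintype.subsetP => y; rewrite !inE => /le_trans; exact.
Qed.

Lemma down_top p q s : p \in s -> s \subset down p ->
  q \in s -> s \subset down q -> p = q.
Proof.
move=> ps sp qs sq; apply/le_anti.
have := fintype.subsetP sp _ qs; have := fintype.subsetP sq _ ps.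
by rewrite !inE => -> ->.
Qed.

Definition barycenter s : {ptws L -> R} :=
  fun q => if q \in s then #|s|%:R^-1 else 0.

Lemma supp_barycenter s : supp (barycenter s) = s.
Proof.
apply/setP => q; rewrite inE /barycenter.
case: ifPn => qs; last by rewrite eqxx.
rewrite invr_eq0 pnatr_eq0 -lt0n card_gt0; apply/finset.set0Pn.
by exists q.
Qed.

Lemma barycenter_realization A s :
  is_simplex A s -> realization A (barycenter s).
Proof.
move=> sA; split=> [q|/=|]; last by rewrite supp_barycenter.
- by rewrite /barycenter; case: ifP => // _; rewrite invr_ge0.
- rewrite /barycenter -big_mkcond /= sumr_const -[_ *+ _]mulr_natr mulVf //.
  by rewrite pnatr_eq0 -lt0n card_gt0; case: sA.
Qed.

Definition point A (a : {ptws L -> R}) (aA : realization A a) :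
    order_complex R A :=
  exist (fun a => a \in realization A) a (mem_set aA).

Lemma coordP A (a : order_complex R A) : realization A (coord a).
Proof. exact: set_valP. Qed.

Definition simplex_dim s : nat := #|s|.-1.

Lemma simplex_dimS A s : is_simplex A s -> (simplex_dim s).+1 = #|s|.
Proof. by case=> s0 _ _; rewrite /simplex_dim prednK // card_gt0. Qed.

Lemma open_simplex_n0 A s : is_simplex A s ->
  open_simplex (R := R) (A := A) s !=set0.
Proof.
move=> sA; exists (point (barycenter_realization sA)).
exact: supp_barycenter.
Qed.

Lemma order_index A :
  indexes (order_cells R A) (fun s => `[< is_simplex A s >]) simplex_dim
    (@open_simplex R _ L A).
Proof.
split=> [d C|s /asboolP|s s' a _ _ <- <-] //; last exact: open_simplex_n0.
split=> [[s [sA sd ->]]|[s [/asboolP sA sd ->]]]; exists s; split=> //.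
- exact/asboolP.
- by rewrite /simplex_dim sd.
- by rewrite -sd (simplex_dimS sA).
Qed.

Lemma ptws_cvg (u : nat -> {ptws L -> R}) (v : {ptws L -> R}) :
  (forall q, (fun n => u n q) @ \oo --> v q) -> u @ \oo --> v.
Proof.
move=> uv; apply/cvg_sup => q.
rewrite cvg_image; last by rewrite eqEsubset; split=> y // _; exists (cst y).
move=> W /= /uv Wu; exists (@^~ q @^-1` W) => //.
by rewrite eqEsubset; split=> [y [a aW <-]|y yW] //; exists (cst y).
Qed.

Lemma coord_continuous A q :
  continuous (fun a : order_complex R A => coord a q).
Proof.
move=> a; have ca : coord x @[x --> a] --> (coord a : {ptws L -> R}).
  exact: (@initial_continuous (order_complex R A) {ptws L -> R} set_val).
exact: cvg_comp ca (@proj_continuous _ (fun _ : L => R) q (coord a)).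
Qed.

Definition segment p s (t : R) : {ptws L -> R} :=
  fun q => (1 - t) * vertex_coord R p q + t * barycenter s q.

Lemma barycenter_gt0 s q : q \in s -> 0 < barycenter s q.
Proof.
move=> qs; rewrite /barycenter qs invr_gt0 ltr0n card_gt0.
by apply/finset.set0Pn; exists q.
Qed.

Lemma supp_segment p s t : 0 < t <= 1 -> p \in s -> supp (segment p s t) = s.
Proof.
move=> /andP[t0 t1] ps; apply/setP => q; rewrite inE /segment.
have [qs|qs] := boolP (q \in s).
  apply: lt0r_neq0; apply: ltr_wpDl; last by rewrite mulr_gt0 ?barycenter_gt0.
  by rewrite mulr_ge0 ?subr_ge0 ?ler0n.
rewrite /barycenter (negPf qs) /vertex_coord (_ : q == p = false).
  by rewrite !mulr0 addr0 eqxx.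
by apply: contraNF qs => /eqP ->.
Qed.

Lemma segment_realization A p s t : 0 < t <= 1 -> p \in s -> is_simplex A s ->
  realization A (segment p s t).
Proof.
move=> t01 ps sA; have [b0 b1 _] := barycenter_realization sA.
have [v0 v1 _] := coordP (vertex R p).
have /andP[t0 t1] := t01; split=> [q||]; last by rewrite supp_segment.
  by rewrite addr_ge0 ?mulr_ge0 ?subr_ge0 ?(ltW t0) ?b0 ?(v0 : forall q, _).
by rewrite big_split -!mulr_sumr /= b1 [X in _ * X + _]v1 !mulr1 subrK.
Qed.

(** The open star is thus made of the simplices that have [p] as an element. If
    [p] lies in [s], the points of the half-open segment from [p] to the
    barycenter lie in the open simplex and tend to [p]. Otherwise the coordinate
    at [p], which is continuous, is 0 on the simplex and 1 at the vertex. *)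
Lemma closure_open_simplex p s : is_simplex (down p) s ->
  closure (open_simplex (R := R) (A := down p) s) (vertex R p) <-> p \in s.
Proof.
move=> sp; split=> [clp|ps].
  have : \forall a \near vertex R p, 0 < coord a p.
    apply: (cvgr_gt _ (@coord_continuous _ p (vertex R p))).
    by rewrite -[coord _ p]/((p == p)%:R) eqxx ltr01.
  by move=> /clp[a [<- /lt0r_neq0 ap]]; rewrite inE.
have t01 n : 0 < (n.+1%:R^-1 : R) <= 1.
  by rewrite invr_gt0 ltr0n invf_le1 ?ler1n ?ltr0n.
pose u n := point (segment_realization (t01 n) ps sp).
have uv : u @ \oo --> vertex R p.
  move=> U [_ /= [[W oW <-]] Wv /filterS]; apply.
  suff uv : (fun n => segment p s n.+1%:R^-1) @ \oo --> vertex_coord R p.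
    by apply: uv; exact: open_nbhs_nbhs.
  apply: ptws_cvg => q; rewrite /segment.
  rewrite -[X in _ --> X]addr0 -[X in _ --> X + _]mul1r.
  rewrite -(mul0r (barycenter s q)).
  have t0 : (n.+1%:R^-1 : R) @[n --> \oo] --> 0 := cvg_harmonic.
  apply: cvgD; apply: cvgMr_tmp => //.
  rewrite -[X in _ --> X]subr0; apply: cvgB => //; exact: cvg_cst.
move=> B /uv [n _ /(_ n (leqnn n))] Bn; exists (u n); split=> //.
exact: supp_segment.
Qed.

Definition star_simplex p s : bool :=
  `[< is_simplex (down p) s >] && (p \in s).

Lemma star_index p :
  indexes (star_cells R p) (star_simplex p) simplex_dim
    (@open_simplex R _ L (down p)).
Proof.
have [cE n0 disj] := order_index (down p).
split=> [d C|s /andP[/n0]|s s' a /andP[sp _] /andP[s'p _]] //; last exact: disj.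
split=> [[/cE[s [/asboolP sp sd ->]] /(closure_open_simplex sp) ps]|].
  by exists s; split=> //; apply/andP; split=> //; apply/asboolP.
move=> [s [/andP[sp ps] sd ->]]; split; first by apply/cE; exists s.
exact/(closure_open_simplex (asboolP _ sp)).
Qed.
End OrderCells.

(** * The inclusions between joins *)

Section JoinInclusion.
Variables (R : realType) (X : topologicalType).

(** The weighted points that make up a point of a join. As a set it forgets the
    number of copies, so that joins of different lengths can be compared without
    casts; the inclusions between joins preserve it. *)
Definition prejoin_code n (z : prejoin R X n) : set (nat * R * X) :=
  [set (val i, weight z i, node z i) | i in [set i | weight z i != 0]].

Definition join_code n (x : join R X n) := prejoin_code (repr x).

Lemma prejoin_code_inj n (z z' : prejoin R X n) :
  prejoin_code z = prejoin_code z' -> join_pi z = join_pi z'.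
Proof.
move=> zz'.
have half (z1 z2 : prejoin R X n) : prejoin_code z1 `<=` prejoin_code z2 ->
    forall i, weight z1 i != 0 ->
    weight z1 i = weight z2 i /\ node z1 i = node z2 i.
  move=> z12 i wi; have /z12[j _ [/val_inj -> -> ->]] //:
    prejoin_code z1 (val i, weight z1 i, node z1 i) by exists i.
apply/join_piP; split=> [|i wi]; last first.
  by have [] := half z z' _ i wi; rewrite ?zz'.
apply/funext => i; have [wi|] := eqVneq (weight z i) 0; last first.
  by move=> wi; have [] := half z z' _ i wi; rewrite ?zz'.
rewrite wi; apply/eqP; rewrite eq_sym; apply: contraTT isT => w'i.
have [|+ _] := half z' z _ i w'i; first by rewrite zz'.
by rewrite wi => w0; rewrite w0 eqxx in w'i.
Qed.

Lemma join_code_pi n (z : prejoin R X n) :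
  join_code (join_pi z) = prejoin_code z.
Proof.
have /join_piP[wE nE] : join_pi (repr (join_pi z)) = join_pi z by exact: reprK.
apply/seteqP; split=> k [i /= wi <-]; exists i => //=.
- by rewrite -wE.
- by rewrite -nE // wE.
- by rewrite wE.
- by rewrite nE wE.
Qed.

Lemma join_code_inj n : injective (@join_code n).
Proof.
by move=> x y xy; rewrite -[x]reprK -[y]reprK; exact: (prejoin_code_inj xy).
Qed.

Section Widen.
Variables (n m : nat) (h : (n <= m)%N).

Lemma widen_inj : injective (widen_ord h).
Proof. by move=> i j /(congr1 val) /= ij; apply: val_inj. Qed.

Variant widen_spec (j : 'I_m) : Prop :=
| InImage i of j = widen_ord h i
| NotInImage of (n <= j)%N.

Lemma widenP j : widen_spec j.
Proof.
have [jn|] := ltnP j n; last exact: NotInImage.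
by apply: (@InImage _ (Ordinal jn)); apply: val_inj.
Qed.

Lemma sum_widen (V : nmodType) (F : 'I_m -> V) :
  (forall j : 'I_m, (n <= j)%N -> F j = 0) ->
  \sum_j F j = \sum_i F (widen_ord h i).
Proof.
move=> F0; rewrite -(big_ord_narrow h) [RHS]big_mkcond; apply: eq_bigr => j _.
by case: ltnP => // /F0.
Qed.

Definition extend (T : Type) (f : {ffun 'I_n -> option T}) :
    {ffun 'I_m -> option T} :=
  [ffun j => oapp f None [pick i | widen_ord h i == j]].

Lemma pick_widen i :
  [pick i' | widen_ord h i' == widen_ord h i] = Some i.
Proof. by case: pickP => [i' /eqP/widen_inj -> //|/(_ i)]; rewrite eqxx. Qed.

Lemma extend_widen T (f : {ffun 'I_n -> option T}) i :
  extend f (widen_ord h i) = f i.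
Proof. by rewrite ffunE pick_widen. Qed.

Lemma extend_high T (f : {ffun 'I_n -> option T}) (j : 'I_m) :
  (n <= j)%N -> extend f j = None.
Proof.
by rewrite ffunE; case: pickP => // i /eqP <- /=; rewrite leqNgt ltn_ord.
Qed.

Lemma incl_weight_widen (z : prejoin R X n) i :
  weight (prejoin_incl h z) (widen_ord h i) = weight z i.
Proof.
by rewrite -[LHS]/(incl_weight h z _) /incl_weight (big_pred1 i).
Qed.

Lemma incl_weight_high (z : prejoin R X n) (j : 'I_m) : (n <= j)%N ->
  weight (prejoin_incl h z) j = 0.
Proof.
move=> nj; rewrite -[LHS]/(incl_weight h z _) /incl_weight big1 // => i /eqP ij.
by move: nj; rewrite -ij /= leqNgt ltn_ord.
Qed.

Lemma incl_node_widen (z : prejoin R X n) i :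
  node (prejoin_incl h z) (widen_ord h i) = node z i.
Proof. by rewrite /node /= pick_widen. Qed.

Lemma join_code_incl (x : join R X n) : join_code (join_incl h x) = join_code x.
Proof.
rewrite join_code_pi; apply/seteqP; split=> k [].
- move=> j; rewrite /mkset; have [i ->|nj] := widenP j.
    by rewrite incl_weight_widen incl_node_widen => wi <-; exists i.
  by rewrite incl_weight_high ?eqxx.
- move=> i; rewrite /mkset => wi <-; exists (widen_ord h i); rewrite /mkset.
    by rewrite incl_weight_widen.
  by rewrite incl_weight_widen incl_node_widen.
Qed.

Variables (T : finType) (c : T -> set X).

(** The inclusion maps a cell onto a cell, not merely into one: a point that
    puts no weight on the new copies already comes from the smaller join. *)
Lemma label_cell_incl (f : {ffun 'I_n -> option T}) :
  @join_incl R X n m h @` label_cell (R := R) c f =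
  label_cell (R := R) c (extend f).
Proof.
apply/seteqP; split=> [_ [_ [z zf <-] <-]|_ [z' z'f <-]].
  rewrite join_inclE; exists (prejoin_incl h z) => // j.
  have [i ->|nj] := widenP j; last by rewrite extend_high // incl_weight_high.
  by rewrite extend_widen incl_weight_widen incl_node_widen; exact: zf.
have z'0 (j : 'I_m) : (n <= j)%N -> weight z' j = 0.
  by move=> nj; have := z'f j; rewrite extend_high.
pose w : {ptws 'I_n -> R} := fun i => weight z' (widen_ord h i).
have w1 : w \in std_simplex R n.
  have [w'0 w'1] := set_mem (valP z'.1).
  apply/mem_set; split=> [i|]; first exact: w'0.
  by rewrite -(sum_widen z'0).
pose z : prejoin R X n :=
  (exist (fun t => t \in std_simplex R n) w w1,
   fun i => node z' (widen_ord h i)).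
exists (join_pi z).
  exists z => // i; have := z'f (widen_ord h i).
  by rewrite extend_widen.
rewrite join_inclE; apply/join_piP; split=> [|j].
  apply/funext => j; have [i ->|nj] := widenP j.
    by rewrite incl_weight_widen.
  by rewrite incl_weight_high // z'0.
have [i ->|nj] := widenP j; first by rewrite incl_node_widen.
by rewrite incl_weight_high ?eqxx.
Qed.

Lemma extend_nonempty (f : {ffun 'I_n -> option T}) :
  nonempty_label f -> nonempty_label (extend f).
Proof.
rewrite !label_supp_n0 => /finset.set0Pn[i]; rewrite inE => fi.
by apply/finset.set0Pn; exists (widen_ord h i); rewrite inE extend_widen.
Qed.

Lemma label_dim_extend (dim : T -> nat) (f : {ffun 'I_n -> option T}) :
  label_dim dim (extend f) = label_dim dim f.
Proof.
congr _.-1; rewrite (@sum_widen nat) => [|j nj]; last by rewrite extend_high.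
by apply: eq_bigr => i _; rewrite extend_widen.
Qed.
End Widen.
End JoinInclusion.

(** * Cells of the Engstrom representation *)

Section EngstromCells.
Variables (R : realType) (X : topologicalType).
Variables (E : finType) (M : matroid E).

(** Both components are preserved by each generating identification, hence by
    the equivalence relation that they generate. *)
Definition engstrom_code (u : engstrom_coprod R X M) :
    (flat M -> R) * set (nat * R * X) :=
  (coord (tagged u).1, join_code (tagged u).2).

Lemma engstrom_pi_code (u v : engstrom_coprod R X M) :
  engstrom_pi u = engstrom_pi v -> engstrom_code u = engstrom_code v.
Proof.
move=> /eqmodP/asboolP.
elim=> {u v} [u v [h [uv1 uv2]]|//|u v _ ->|u v w _ -> _ ->] //.
by congr pair => //; rewrite -uv1 join_code_incl.
Qed.

Lemma engstrom_pi_step (u v : engstrom_coprod R X M) :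
  engstrom_step u v -> engstrom_pi u = engstrom_pi v.
Proof. by move=> uv; apply/eqmodP/asboolP; exact: rst_step. Qed.

Variables (K : cells X) (T : finType) (dim : T -> nat) (c : T -> set X).
Hypothesis idxK : indexes K xpredT dim c.

Definition product_cell (p : flat M) (s : {set flat M})
    (f : {ffun 'I_(corank p) -> option T}) : set (engstrom R X M) :=
  [set engstrom_pi (existT (@engstrom_piece R X E M) p z) |
    z in open_simplex (R := R) (A := down p) s `*` label_cell (R := R) c f].

(** A product cell over [p] is identified with one over any smaller flat [q]
    that still bounds the chain [s] from above. The least such flat is the top
    of [s], which gives each cell a canonical description. *)
Lemma product_cell_top (p q : flat M) (h : (q <= p)%O) (s : {set flat M})
    (f : {ffun 'I_(corank p) -> option T}) :
  s \subset down q ->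
  product_cell s f = product_cell s (extend (corank_le h) f).
Proof.
move=> sq; apply/seteqP; split=> _ [[a x] [/= sa xf] <-].
  have aq : realization (down q) (coord a).
    have [a0 a1 [s0 _ sC]] := coordP a; split=> //; split=> //.
    by rewrite sa.
  exists (point aq, join_incl (corank_le h) x).
    by split=> //=; rewrite -label_cell_incl; exists x.
  by apply/esym/engstrom_pi_step; exists h.
move: xf; rewrite -label_cell_incl => -[y yf yx].
have ap : realization (down p) (coord a).
  have [a0 a1 [s0 _ sC]] := coordP a; split=> //; split=> //.
  rewrite sa; apply: (fintype.subset_trans sq).
  by apply/fintype.subsetP => r; rewrite !inE => /le_trans; exact.
exists (point ap, y); first by split.
by apply: engstrom_pi_step; exists h.
Qed.

Definition product_index :=
  {p : flat M & ({set flat M} * {ffun 'I_(corank p) -> option T})%type}.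

(** Requiring [tag x] to be the top of the chain selects one description of each
    cell. *)
Definition canonical (x : product_index) : bool :=
  star_simplex (tag x) (tagged x).1 && nonempty_label (tagged x).2.
Definition product_dim (x : product_index) : nat :=
  (simplex_dim (tagged x).1 + label_dim dim (tagged x).2)%N.
Definition indexed_cell (x : product_index) :=
  product_cell (tagged x).1 (tagged x).2.

(** Every cell has a canonical description by [product_cell_top]. It has only
    one: the barycentric coordinates of any of its points have the chain as
    support, whose top is the flat, and the code of that point then fixes the
    point of the join. *)
Lemma engstrom_index :
  indexes (engstrom_cells R M K) canonical product_dim indexed_cell.
Proof.
have oidx p := order_index R (down p : {set flat M}).
have jidx p := join_index R idxK (corank (p : flat M)).
split=> [d C|[p [s f]] /andP[/andP[/= sp _] f0]|].
- split=> [[p [i [j [so [e [oc jc -> ->]]]]]]|].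
    have /(index_cells (oidx p))[s [/asboolP sp <- ->]] := oc.
    have /(index_cells (jidx p))[f [f0 <- ->]] := jc.
    have [q qs sq] := chain_top sp.
    have qp : (q <= p)%O.
      by case: sp => _ /fintype.subsetP/(_ q qs) + _; rewrite inE.
    exists (existT _ q (s, extend (corank_le qp) f)); split.
    + rewrite /canonical /star_simplex /= qs extend_nonempty // !andbT.
      apply/asboolP.
      by case: sp => s0 _ sC; split.
    + by rewrite /product_dim /= label_dim_extend.
    + exact: product_cell_top.
  move=> [[p [s f]] [/andP[/andP[/= sp ps] f0] <- ->]].
  exists p, (simplex_dim s), (label_dim dim f).
  exists (open_simplex s), (label_cell c f).
  split=> //.
    by apply/(index_cells (oidx p)); exists s.
  by apply/(index_cells (jidx p)); exists f.
- have [a sa] := index_nonempty (oidx p) sp.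
  have [x fx] := index_nonempty (jidx p) f0.
  by exists (engstrom_pi (existT (@engstrom_piece R X E M) p (a, x))), (a, x).
- move=> [p [s f]] [q [t g]] w /andP[/andP[/= /asboolP sp ps] f0].
  move=> /andP[/andP[/= /asboolP tq qt] g0] [[a x] [/= sa fx] <-].
  move=> [[b y] [/= tb gy] /engstrom_pi_code[ba yx]].
  have st : s = t by rewrite -sa -tb ba.
  have [[_ sdp _] [_ tdq _]] := (sp, tq); subst t.
  have pq : p = q := down_top ps sdp qt tdq; subst q.
  congr existT; congr pair; apply: (index_disjoint (jidx p) f0 g0 fx).
  by rewrite -(join_code_inj yx).
Qed.

(** The factor ['X] reflects that the exponents are dimensions plus one: those
    of the two factors of a product cell add up to one more than the exponent
    of the product. *)
Lemma fpoly_engstrom :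
  (fpoly (engstrom_cells R M K) - 1) * 'X =
  \sum_(p : flat M)
    (fpoly (star_cells R p) - 1) * (fpoly K ^+ corank p - 1).
Proof.
have sub1 (a b : {poly int}) : a = 1 + b -> a - 1 = b.
  by move=> ->; rewrite addrC addKr.
rewrite (sub1 _ _ (fpoly_index engstrom_index)) mulr_suml.
rewrite (eq_bigr (fun p => \sum_(s | star_simplex p s)
    \sum_(f : {ffun 'I_(corank p) -> option T} | nonempty_label f)
      'X^((simplex_dim s).+1) * 'X^((label_dim dim f).+1))); last first.
  move=> p _; rewrite -(fpoly_join R idxK).
  rewrite (sub1 _ _ (fpoly_index (star_index R p))).
  rewrite (sub1 _ _ (fpoly_index (join_index R idxK _))) mulr_suml.
  by apply: eq_bigr => s _; rewrite mulr_sumr.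
under eq_bigr do rewrite pair_big_dep.
rewrite sig_big_dep; apply: eq_bigr => -[p [s f]] _.
by rewrite -exprD -exprSr /product_dim /= addSn addnS.
Qed.
End EngstromCells.

Theorem theorem3p1 (R : realType) (X : topologicalType) (K : cells X)
    (hK : finite_regular_cw R K) (E : finType) (M : matroid E) :
  (fpoly (engstrom_cells R M K))%:F =
  1 + \sum_(p : flat M)
        ((fpoly (star_cells R p) - 1) * (fpoly K ^+ corank p - 1))%:F / 'X%:F
  :> {fraction {poly int}}.
Proof.
have [T [dim [c idxK]]] := cw_index hK.
have X0 : 'X%:F != 0 :> {fraction {poly int}} by rewrite tofrac_eq0 polyX_eq0.
rewrite -mulr_suml -rmorph_sum -(fpoly_engstrom R M idxK) rmorphM /= mulfK //.
by rewrite rmorphB rmorph1 addrC subrK.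
Qed.
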